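(* Let $n,m,q,r$ be positive integers, $A\in\mathbb{R}^{m\times n}$, $P\in\mathbb{R}^{q\times n}$, $Z\in\mathbb{R}^{q\times r}$ with $\ker Z^T=\{0\}$, $b\in\mathbb{R}^m$, and consider the vector linear program $$\text{(VLP)}\qquad\text{minimize } Px\ \text{ s.t. } Ax\ge b$$ with respect to the ordering cone $C=\{y\in\mathbb{R}^q\mid Z^Ty\ge0\}$, together with the associated polyhedral projection problem $$\text{(PP)}\qquad\text{compute }\mathcal{P}=\{y\in\mathbb{R}^q\mid\exists x\in\mathbb{R}^n:\ Z^Ty\ge Z^TPx,\ Ax\ge b\}.$$ Suppose (VLP) is feasible, and let $L:=0^+\mathcal{P}\cap(-0^+\mathcal{P})$ be the lineality space of $\mathcal{P}$. Then: (1) A solution of (PP) exists. (2) Let $(X^{\mathrm{poi}},X^{\mathrm{dir}})$ be a solution of (PP). If $L\cap C=\{0\}$, then with $$S^{\mathrm{poi}}:=\{x\in\mathbb{R}^n\mid (x,y)\in X^{\mathrm{poi}},\ y\notin\mathcal{P}+C\setminus\{0\}\},$$ $$S^{\mathrm{dir}}:=\{x\in\mathbb{R}^n\mid (x,y)\in X^{\mathrm{dir}},\ y\notin0^+\mathcal{P}+C\setminus\{0\}\},$$ the pair $(S^{\mathrm{poi}},S^{\mathrm{dir}})$ is a solution of (VLP). (3) If $L\cap C\ne\{0\}$, then (VLP) has no solution.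
   Context: Inequalities between vectors are componentwise. For nonempty $B$, $\operatorname{conv}B$ is the convex hull and $\operatorname{cone}B=\{\lambda x\mid\lambda\ge0,\ x\in\operatorname{conv}B\}$; $\operatorname{cone}\emptyset=\{0\}$. $0^+$ denotes the recession cone. $A'+C\setminus\{0\}$ means $A'+(C\setminus\{0\})$ (Minkowski sum). In the definitions of $S^{\mathrm{poi}},S^{\mathrm{dir}}$, the set consists of all $x$ for which there is some $y$ with the listed properties. Solution of (VLP): Let $S=\{x\in\mathbb{R}^n\mid Ax\ge b\}$ and $0^+S=\{x\in\mathbb{R}^n\mid Ax\ge0\}$; (VLP) is feasible if $S\ne\emptyset$. For $X\subseteq\mathbb{R}^n$, $P[X]=\{Px\mid x\in X\}$. Note that $\mathcal{P}=P[S]+C$ (the upper image). A point $x\in S$ is a minimizer if $Px\notin P[S]+C\setminus\{0\}$; a direction $x\in0^+S\setminus\{0\}$ is a minimizer if $Px\notin P[0^+S]+C\setminus\{0\}$. A pair $(S^{\mathrm{poi}},S^{\mathrm{dir}})$ is a solution to (VLP) if $S^{\mathrm{poi}}$ is a nonempty finite subset of $S$, $S^{\mathrm{dir}}$ is a finite subset of $0^+S\setminus\{0\}$, $\operatorname{conv}P[S^{\mathrm{poi}}]+\operatorname{cone}P[S^{\mathrm{dir}}]+C=\mathcal{P}$, and all elements of $S^{\mathrm{poi}}$ and $S^{\mathrm{dir}}$ are minimizers. Solution of (PP): A pair $(X^{\mathrm{poi}},X^{\mathrm{dir}})$ is a solution to (PP) if $X^{\mathrm{poi}}$ is a nonempty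 finite set of points $(x,y)\in\mathbb{R}^n\times\mathbb{R}^q$ with $Z^Ty\ge Z^TPx$, $Ax\ge b$; $X^{\mathrm{dir}}$ is a finite set of directions $(x,y)\in\mathbb{R}^n\times(\mathbb{R}^q\setminus\{0\})$ with $Z^Ty\ge Z^TPx$, $Ax\ge0$; and $\mathcal{P}=\operatorname{conv}\operatorname{proj}X^{\mathrm{poi}}+\operatorname{cone}\operatorname{proj}X^{\mathrm{dir}}$, where $\operatorname{proj}$ is the projection $(x,y)\mapsto y$. *)

(* Defs.v *)
(* The real numbers are an arbitrary [R : realType]. *)
From HB Require Import structures.
From mathcomp Require Import all_boot all_order all_algebra.
From mathcomp Require Import boolp classical_sets cardinality reals convex.

Set Implicit Arguments.
Unset Strict Implicit.
Unset Printing Implicit Defensive.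

Import Order.TTheory GRing.Theory Num.Theory.

Local Open Scope classical_set_scope.
Local Open Scope ring_scope.

Reserved Notation "u <=c v" (at level 70, no associativity).
Reserved Notation "A ⊕ B" (at level 54, left associativity).

Definition vec_le (R : realType) (k : nat) (u v : 'cV[R]_k) : Prop :=
  forall i, u i 0 <= v i 0.
Notation "u <=c v" := (vec_le u v) : ring_scope.

(* The library's [A `+` B] is the symmetric difference, hence a new symbol for
   the Minkowski sum. *)
Definition minkowski_sum (V : zmodType) (A B : set V) : set V :=
  [set a + b | a in A & b in B].
Notation "A ⊕ B" := (minkowski_sum A B) : classical_set_scope.

Section Convex.
Context (R : realType) (V : lmodType R).
Implicit Types B X : set V.

Definition conv_hull B : set V := smallest (@convex_set R V) B.

(* [conv_hull set0] is empty, so the union with {0} gives cone of the empty set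
   = {0}; for nonempty [B] it adds nothing, as l = 0 already yields 0. *)
Definition cone_hull B : set V :=
  [set 0] `|` [set l *: x | l in [set l : R | 0 <= l] & x in conv_hull B].

Definition recession_cone X : set V :=
  [set d | forall x (t : R), X x -> 0 <= t -> X (x + t *: d)].

Definition lineality_space X : set V :=
  recession_cone X `&` [set - d | d in recession_cone X].

End Convex.

Section VLP.
Context (R : realType) (n m q r : nat).
Context (A : 'M[R]_(m, n)) (P : 'M[R]_(q, n)) (Z : 'M[R]_(q, r)) (b : 'cV[R]_m).

Definition ordering_cone : set 'cV[R]_q := [set y | 0 <=c Z^T *m y].
Local Notation C := ordering_cone.

Definition feasible_set : set 'cV[R]_n := [set x | b <=c A *m x].

(* This is the recession cone of [feasible_set] when the latter is nonempty,
   see [recession_cone_feasible_set]. *)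
Definition feasible_dirs : set 'cV[R]_n := [set x | 0 <=c A *m x].

Definition upper_image : set 'cV[R]_q :=
  [set y | exists x : 'cV[R]_n, Z^T *m (P *m x) <=c Z^T *m y /\ b <=c A *m x].

Definition point_minimizer (x : 'cV[R]_n) : Prop :=
  feasible_set x /\ ~ (mulmx P @` feasible_set ⊕ (C `\ 0)) (P *m x).

Definition dir_minimizer (x : 'cV[R]_n) : Prop :=
  (feasible_dirs `\ 0) x /\ ~ (mulmx P @` feasible_dirs ⊕ (C `\ 0)) (P *m x).

Definition vlp_solution (Spoi Sdir : set 'cV[R]_n) : Prop :=
  [/\ [/\ Spoi !=set0, finite_set Spoi & Spoi `<=` feasible_set],
      finite_set Sdir /\ Sdir `<=` feasible_dirs `\ 0,
      conv_hull (mulmx P @` Spoi) ⊕ cone_hull (mulmx P @` Sdir) ⊕ C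
        = upper_image,
      forall x, Spoi x -> point_minimizer x
    & forall x, Sdir x -> dir_minimizer x].

Definition pp_solution (Xpoi Xdir : set ('cV[R]_n * 'cV[R]_q)) : Prop :=
  [/\ [/\ Xpoi !=set0, finite_set Xpoi
        & forall x y, Xpoi (x, y) ->
            Z^T *m (P *m x) <=c Z^T *m y /\ b <=c A *m x],
      finite_set Xdir,
      forall x y, Xdir (x, y) ->
        [/\ y <> 0, Z^T *m (P *m x) <=c Z^T *m y & 0 <=c A *m x]
    & upper_image = conv_hull (snd @` Xpoi) ⊕ cone_hull (snd @` Xdir)].

Lemma recession_cone_feasible_set :
  feasible_set !=set0 -> recession_cone feasible_set = feasible_dirs.
Proof.
have zE i : (0 : 'cV[R]_m) i 0 = 0 by rewrite mxE.
have AE x t d i : (A *m (x + t *: d)) i 0 = (A *m x) i 0 + t * (A *m d) i 0.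
  by rewrite mulmxDr -scalemxAr mxE [X in _ + X]mxE.
move=> [x0 Sx0]; apply/seteqP; split=> d /=.
- move=> recd i; rewrite zE leNgt; apply/negP => d_lt0.
  set s := (A *m x0) i 0 - b i 0 + 1.
  have s_gt0 : 0 < s by rewrite ltr_wpDl// subr_ge0; exact: Sx0.
  pose t := s / - (A *m d) i 0.
  have t_ge0 : 0 <= t by apply: divr_ge0; rewrite ?oppr_ge0 ltW.
  have := recd _ _ Sx0 t_ge0 i; rewrite AE.
  have -> : t * (A *m d) i 0 = - s.
    by rewrite /t invrN mulrN mulNr -mulrA mulVf ?mulr1// lt_eqF.
  by rewrite /s opprD opprB addrA [_ + (b i 0 - _)]addrC subrK lerDl oppr_ge0 ler10.
- move=> Ad x t Sx t_ge0 i; rewrite AE -[X in X <= _]addr0 lerD//.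
  by rewrite mulr_ge0//; have := Ad i; rewrite zE.
Qed.

End VLP.

(* Main.v *)
Require Import Defs.
From mathcomp Require Import all_boot all_order all_algebra.
From mathcomp Require Import boolp classical_sets cardinality reals convex.
From mathcomp Require Import interval_inference lra ring.

(** Write [C] for the ordering cone, which is pointed because [ker Z^T = 0], and
    [PP] for the upper image. Call [y] undominated with respect to a set [Y] if it
    is not in [Y + C \ {0}].

    Existence of a solution of the projection problem is the Minkowski-Weyl
    theorem ([minkowski_weyl]) for the polyhedron of pairs [(x, y)]: its finitely
    many generators project to generators of [PP]. The theorem is obtained by
    homogenization from its version for cones, which is proved by intersecting a
    finitely generated cone with one halfspace after another
    ([conic_halfspace]).

    Suppose that [L] meets [C] only in [0]. The point is that dominated generators
    can be discarded, at the price of adding [C]. Every [y] in [PP] lies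
    above an undominated point of [PP] ([undominated_below]): one minimizes a
    linear function that is positive on [C \ {0}] over the points of [PP] below
    [y], and the minimum is attained ([linear_program_attained]) since these
    points form a set without nonzero recession directions. Write the
    undominated point as a combination of generators of [PP]. A generator that
    occurs with positive weight is undominated, for otherwise exchanging it for
    a point or direction that dominates it would show that the combination
    is dominated ([undominated_conv], [undominated_cone]). Finally, an undominated
    generator [y] coming from a pair [(x, y)] equals [P x] because [y - P x] is in
    [C] ([undominated_eq_image]); hence [x] is a minimizer, and these [x] generate
    [PP] together with [C].

    Conversely, if [L] contains a nonzero [c] in [C], then [P x - c] is in [PP] for
    every feasible [x], so no feasible point is a minimizer
    ([vlp_no_solution]). *)

Import Order.TTheory GRing.Theory Num.Theory.

Set Implicit Arguments.
Unset Strict Implicit.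
Unset Printing Implicit Defensive.

Local Open Scope classical_set_scope.
Local Open Scope ring_scope.

(** * Convex sets and convex cones *)

Section convex_cones.
Context {R : realFieldType} {V : lmodType R}.
Implicit Types (X K : set V) (x y : V).

Lemma convex_setP X : @convex_set R V X <->
  forall x y (t : R), 0 < t < 1 -> X x -> X y -> X (t *: x + (1 - t) *: y).
Proof.
split=> [cX x y t /andP[t0 t1] Xx Xy|cX].
  have := cX x y (Itv01 (ltW t0) (ltW t1)).
  by rewrite !inE; apply.
apply/convex_setW => x y; rewrite !inE => Xx Xy k k0 k1.
by rewrite inE; apply: cX => //; rewrite k0.
Qed.

(** Nonnegative weights that need not sum to one are brought back to a convex
    combination by dividing by their sum. *)
Lemma convex_set_mix X p q (a c : R) : @convex_set R V X -> X p -> X q ->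
  0 <= a -> 0 <= c -> 0 < a + c ->
  exists2 s, X s & a *: p + c *: q = (a + c) *: s.
Proof.
move=> /convex_setP cX Xp Xq; rewrite !le_eqVlt.
move=> /predU1P[<- _ _|a0]; first by exists q => //; rewrite scale0r !add0r.
move=> /predU1P[<- _|c0 ac0]; first by exists p => //; rewrite scale0r !addr0.
exists ((a / (a + c)) *: p + (1 - a / (a + c)) *: q).
  apply: cX => //; rewrite divr_gt0//= ltr_pdivrMr//; lra.
rewrite scalerDr !scalerA; congr (_ *: _ + _ *: _); field; lra.
Qed.

Definition convex_cone K : Prop :=
  [/\ K 0, forall x y, K x -> K y -> K (x + y)
    & forall (l : R) x, 0 <= l -> K x -> K (l *: x)].

Lemma convex_cone_convex K : convex_cone K -> @convex_set R V K.
Proof.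
move=> [_ KD KZ]; apply/convex_setP => x y t /andP[t0 t1] Kx Ky.
by apply: KD; apply: KZ => //; lra.
Qed.

End convex_cones.

Section hulls.
Context {R : realType} {V : lmodType R}.
Implicit Types (X K B D : set V) (x y : V).

Lemma conv_hull_convex B : @convex_set R V (conv_hull B).
Proof.
apply/convex_setP => x y t t01 Bx By X [cX BX].
by move/convex_setP: (cX); apply=> //; [apply: Bx|apply: By].
Qed.

Lemma conv_hull_min B X : @convex_set R V X -> B `<=` X -> conv_hull B `<=` X.
Proof. exact: smallest_sub. Qed.

Lemma sub_conv_hull B : B `<=` conv_hull B.
Proof. exact: sub_gen_smallest. Qed.

Lemma conv_hull_neq0 B : conv_hull B !=set0 -> B !=set0.
Proof.
move=> [x Bx]; apply/set0P/eqP => B0.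
suff : (set0 : set V) x by [].
by apply: conv_hull_min Bx => [? ? ?|]; rewrite ?B0// inE.
Qed.

Lemma cone_hull_cone D : convex_cone (cone_hull D).
Proof.
have hZ (l : R) x : 0 <= l -> cone_hull D x -> cone_hull D (l *: x).
  move=> l0 [->|[k k0 [z Dz <-]]]; first by left; rewrite scaler0.
  by right; exists (l * k); [apply: mulr_ge0|exists z; rewrite ?scalerA].
split=> //; first by left.
move=> x y [->|[k k0 [u Du <-]]]; first by rewrite add0r.
move=> [->|[l l0 [v Dv <-]]].
  by rewrite addr0; right; exists k => //; exists u.
have : 0 <= k + l by apply: addr_ge0.
rewrite le_eqVlt => /predU1P[kl|kl].
  have -> : k = 0 by move: k0 l0 => /=; lra.
  have -> : l = 0 by move: k0 l0 => /=; lra.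
  by left; rewrite !scale0r addr0.
have [s Ds ->] := convex_set_mix (conv_hull_convex (B:=D)) Du Dv k0 l0 kl.
by right; exists (k + l); [apply: ltW|exists s].
Qed.

Lemma cone_hull_min D K : convex_cone K -> D `<=` K -> cone_hull D `<=` K.
Proof.
move=> cK DK x [->|[l l0 [y Dy <-]]]; first by case: cK.
case: (cK) => _ _ KZ; apply: KZ => //.
exact: conv_hull_min (convex_cone_convex cK) DK _ Dy.
Qed.

Lemma sub_cone_hull D : D `<=` cone_hull D.
Proof.
move=> x Dx; right; exists 1; first exact: ler01.
by exists x; [exact: sub_conv_hull|rewrite scale1r].
Qed.

Lemma cone_hullS D D' : D `<=` D' -> cone_hull D `<=` cone_hull D'.
Proof.
move=> DD'; apply: cone_hull_min; first exact: cone_hull_cone.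
by apply: subset_trans DD' _; exact: sub_cone_hull.
Qed.

Lemma recession_cone_cone X : convex_cone (recession_cone X).
Proof.
split=> [x t Xx _|d e rd re x t Xx t0|l d l0 rd x t Xx t0].
- by rewrite scaler0 addr0.
- by rewrite scalerDr addrA; apply: re => //; apply: rd.
- by rewrite scalerA; apply: rd => //; apply: mulr_ge0.
Qed.

Lemma recession_coneD X x d : X x -> recession_cone X d -> X (x + d).
Proof. by move=> Xx /(_ x 1 Xx ler01); rewrite scale1r. Qed.

End hulls.

Section linear_images.
Context {R : realType} {V W : lmodType R} (g : {linear V -> W}).

Lemma conv_hull_image B : g @` conv_hull B `<=` conv_hull (g @` B).
Proof.
apply: (@subset_trans _ (g @` (g @^-1` conv_hull (g @` B)))); last first.
  by move=> _ [x Bx <-].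
apply: image_subset; apply: conv_hull_min => [|x Bx].
  apply/convex_setP => x y t t01 /= Bx By; rewrite linearD !linearZ/=.
  by move/convex_setP: (conv_hull_convex (B := g @` B)); apply.
by apply: sub_conv_hull; exists x.
Qed.

Lemma cone_hull_image D : g @` cone_hull D `<=` cone_hull (g @` D).
Proof.
have [h0 hD hZ] := cone_hull_cone (g @` D).
move=> _ [d Dd <-]; move: d Dd; apply: cone_hull_min.
  split=> [|x y /= hx hy|l x l0 /= hx]; rewrite /= ?linear0 ?linearD ?linearZ//.
  - exact: hD.
  - exact: hZ.
by move=> d Dd; apply: sub_cone_hull; exists d.
Qed.

End linear_images.

(** * Undominated points and their generators *)

Section minimal_generators.
Context {R : realType} {V : lmodType R} (C X : set V).
Hypotheses (cC : convex_cone C) (cX : @convex_set R V X).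

(** Minimality of [y] with respect to [Y] for the preorder of [C]; [y] itself is
    not required to lie in [Y]. *)
Definition undominated (Y : set V) (y : V) : Prop := ~ (Y ⊕ (C `\ 0)) y.

Let CZ (t : R) c : 0 < t -> (C `\ 0) c -> (C `\ 0) (t *: c).
Proof.
move=> t0 [Cc /eqP c0]; case: cC => _ _ hZ; split; first exact: hZ (ltW _) _.
by apply/eqP; rewrite scaler_eq0 negb_or gt_eqF.
Qed.

(** A generator of positive weight in an undominated point is undominated:
    replacing it by a point that dominates it, and keeping the others, would
    produce an element of [X] that dominates the whole combination. As
    [conv_hull Y] is the smallest convex set containing [Y], no explicit weights
    are needed: the points with this property form a convex set. *)
Lemma undominated_conv Y x d : Y `<=` X -> conv_hull Y x ->
  recession_cone X d -> undominated X (x + d) ->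
  conv_hull (Y `&` undominated X) x.
Proof.
move=> YX Yx rd ux.
pose T := [set x | X x /\
  (undominated X (x + d) -> conv_hull (Y `&` undominated X) x)].
suff : T x by case=> _; apply.
apply: conv_hull_min Yx => [|y Yy]; last first.
  split=> [|uy]; first exact: YX.
  apply: sub_conv_hull; split=> // -[u Xu [c Cc ye]]; apply: uy.
  exists (u + d); first exact: recession_coneD.
  by exists c => //; rewrite addrAC ye.
(* The exchange itself: if [u + c = y + d] dominates [y + d], then
   [t u + (1 - t) (z + d)] dominates the combination of [y] and [z]. *)
have half y z (t : R) : 0 < t < 1 -> X y -> X z ->
    undominated X (t *: y + (1 - t) *: z + d) -> undominated X (y + d).
  move=> t01 Xy Xz uyz [u Xu [c Cc ye]]; apply: uyz.
  exists (t *: u + (1 - t) *: (z + d)).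
    by move/convex_setP: cX; apply=> //; exact: recession_coneD.
  exists (t *: c); first by apply: CZ => //; case/andP: t01.
  have -> : t *: y + (1 - t) *: z + d = t *: (y + d) + (1 - t) *: (z + d).
    rewrite !scalerDr addrACA -scalerDl.
    by rewrite (_ : t + (1 - t) = 1) ?scale1r//; ring.
  by rewrite -ye [X in _ = X + _]scalerDr addrAC.
apply/convex_setP => y z t t01 [Xy hy] [Xz hz]; split.
  by move/convex_setP: cX; apply.
move=> uyz; move/convex_setP: (conv_hull_convex (B := Y `&` undominated X)).
apply=> //; [apply: hy|apply: hz]; first exact: half uyz.
apply: (half z y (1 - t)) => //; first by lra.
have -> : 1 - (1 - t) = t by ring.
by rewrite [_ *: z + _]addrC.
Qed.

(** The same exchange for directions. A convex cone of good vectors [k] is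
    obtained by quantifying over all positive multiples [l *: k], since scaling
    a direction inside [x + k] cannot be compensated by moving [x]. *)
Lemma undominated_cone D x k : D `<=` recession_cone X -> X x ->
  cone_hull D k -> undominated X (x + k) ->
  cone_hull (D `&` undominated (recession_cone X)) k.
Proof.
have [r0 rD rZ] := recession_cone_cone X.
move=> Dr Xx Dk ux.
set D' := D `&` _; have [h0 hD hZ] := cone_hull_cone D'.
pose T := [set k | recession_cone X k /\
  forall (l : R) x, 0 < l -> X x -> undominated X (x + l *: k) ->
  cone_hull D' k].
suff : T k by case=> _ /(_ 1 x ltr01 Xx); rewrite scale1r; apply.
apply: cone_hull_min Dk => [|d Dd].
- split=> [|y z [ry hy] [rz hz]|l y]; first by split.
    split=> [|m u m0 Xu]; first exact: rD.
    rewrite scalerDr addrA => uyz; apply: hD.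
      apply: (hy m (u + m *: z)) => //; last by rewrite addrAC.
      by apply: recession_coneD => //; apply: rZ (ltW m0) _.
    apply: (hz m (u + m *: y)) => //.
    by apply: recession_coneD => //; apply: rZ (ltW m0) _.
  rewrite le_eqVlt => /predU1P[<- _|l0 [ry hy]].
    by rewrite scale0r; split.
  split=> [|m u m0 Xu]; first exact: rZ (ltW l0) ry.
  rewrite scalerA => uly; apply: hZ (ltW l0) _.
  by apply: (hy (m * l) u) => //; exact: mulr_gt0.
- split=> [|l u l0 Xu uld]; first exact: Dr.
  apply: sub_cone_hull; split=> // -[e re [c Cc de]]; apply: uld.
  exists (u + l *: e).
    by apply: recession_coneD => //; apply: rZ (ltW l0) _.
  exists (l *: c); first exact: CZ.
  by rewrite -addrA -scalerDr de.
Qed.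
End minimal_generators.

(** * The double description method for cones *)

Section scalar_theory.
Context {R : pzRingType} {V : lmodType R} (f : V -> R).
Hypothesis lin_f : scalar f.

Lemma scalar_add x y : f (x + y) = f x + f y.
Proof. by rewrite -[x]scale1r lin_f mul1r scale1r. Qed.

Lemma scalar_zero : f 0 = 0.
Proof. by apply: (addrI (f 0)); rewrite -scalar_add !addr0. Qed.

Lemma scalar_scale (l : R) x : f (l *: x) = l * f x.
Proof. by rewrite -[l *: x]addr0 lin_f scalar_zero addr0. Qed.

End scalar_theory.

Section double_description.
Context {R : realFieldType} {V : lmodType R}.
Implicit Types (G K : set V) (a : V -> R) (x y z g : V).

(** The cone of nonnegative combinations of [G], presented so that a combination
    is built by adding one ray at a time: the elimination of a constraint below
    is an induction on this construction. *)
Inductive conic G : V -> Prop :=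
| conic0 : conic G 0
| conicD l g x : 0 <= l -> G g -> conic G x -> conic G (l *: g + x).

Lemma conic_sub G K : convex_cone K -> G `<=` K -> conic G `<=` K.
Proof.
move=> [K0 KD KZ] GK x; elim=> // l g {}x l0 /GK Kg _ Kx.
by apply: KD => //; exact: KZ.
Qed.

Lemma conic_cone G : convex_cone (conic G).
Proof.
split; first exact: conic0.
  by move=> x y + Gy; elim=> [|l g {}x l0 Gg _ ih]; rewrite ?add0r// -addrA;
     exact: conicD.
move=> l x l0; elim=> [|k g {}x k0 Gg _ ih].
  by rewrite scaler0; exact: conic0.
by rewrite scalerDr scalerA; apply: conicD => //; exact: mulr_ge0.
Qed.

Lemma sub_conic G : G `<=` conic G.
Proof.
move=> x Gx; rewrite -[x]addr0 -[x in x + _]scale1r.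
by apply: conicD => //; exact: conic0.
Qed.

Lemma conicS G G' : G `<=` G' -> conic G `<=` conic G'.
Proof.
move=> GG'; apply: conic_sub; first exact: conic_cone.
by apply: subset_trans GG' _; exact: sub_conic.
Qed.

Section cut.
Variable a : V -> R.
Hypothesis lin_a : scalar a.

Let aD := scalar_add lin_a.
Let a0 := scalar_zero lin_a.
Let aZ := scalar_scale lin_a.

Lemma conic_eq0 G (s : R) z :
  conic (G `&` [set g | 0 < s * a g]) z -> s * a z <= 0 -> z = 0.
Proof.
suff : conic (G `&` [set g | 0 < s * a g]) z ->
    0 <= s * a z /\ (s * a z <= 0 -> z = 0) by move=> h /h[].
elim=> [|l g {}z l0 [Gg /= ag] _ [az0 ih]]; first by rewrite a0 mulr0.
have lag : 0 <= l * (s * a g) by rewrite mulr_ge0// ltW.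
have -> : s * a (l *: g + z) = l * (s * a g) + s * a z by rewrite lin_a; ring.
split=> [|le0]; first exact: addr_ge0.
rewrite ih; last lra.
have /eqP : l * (s * a g) = 0 by lra.
by rewrite mulf_eq0 (gt_eqF ag) orbF => /eqP ->; rewrite scale0r addr0.
Qed.

(** Whenever [a g] and [a h] have opposite signs, the combination of [g] and [h]
    formed here lies on the hyperplane [a = 0]: it is the point where the segment
    joining the two rays crosses that hyperplane. The combinations of other pairs
    are harmless, being in the cone of [G]. *)
Definition balance G : set V :=
  G `|` [set `|a h| *: g + `|a g| *: h | g in G & h in G].

Let level G := balance G `&` [set x | a x = 0].

(** A ray [g] meeting rays on the other side of the hyperplane is paired with
    them one after the other. Each pairing uses up one of the two partners
    entirely, the rest of the pair being a point of the hyperplane, so that what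
    remains in the end lies on one side only. *)
Lemma conic_absorb G g l z : G g -> a g != 0 -> 0 <= l ->
  conic (G `&` [set h | a g * a h < 0]) z ->
  exists y w, [/\ l *: g + z = y + w, conic (level G) y &
    conic (G `&` [set h | a g * a h < 0]) w \/
    exists2 k, 0 <= k & w = k *: g].
Proof.
move=> Gg ag l0 Gz; elim: Gz l l0 => [l l0|k h {}z k0 [Gh /= agh] Gz ih l l0].
  exists 0, (l *: g); split; [by rewrite addr0 add0r|exact: conic0|].
  by right; exists l.
have [_ cD cZ] := conic_cone (level G).
have ah : a h != 0 by apply: contraTneq agh => ->; rewrite mulr0 ltxx.
pose p := `|a h| *: g + `|a g| *: h.
have Gp : level G p.
  split; first by right; exists g => //; exists h.
  rewrite /= /p aD !aZ; move: agh; case: (ltgtP (a g) 0) ag => // ag _.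
    by rewrite nmulr_rlt0// => ah0; rewrite (ltr0_norm ag) (gtr0_norm ah0); ring.
  by rewrite pmulr_rlt0// => a_h; rewrite (gtr0_norm ag) (ltr0_norm a_h); ring.
have [nag nah] : 0 < `|a g| /\ 0 < `|a h| by rewrite !normr_gt0.
(* The smaller of the two ratios tells which partner is used up first. *)
have [lk|kl] := leP (l / `|a h|) (k / `|a g|).
- exists ((l / `|a h|) *: p), ((k - l / `|a h| * `|a g|) *: h + z); split.
  + rewrite /p scalerDr !scalerA divfK ?gt_eqF// -[RHS]addrA; congr (_ + _).
    by rewrite addrA -scalerDl; congr (_ *: _ + _); ring.
  + by apply: cZ; [exact: divr_ge0|exact: sub_conic].
  + left; apply: conicD => //.
    by rewrite subr_ge0 -ler_pdivlMr.
- have m0 : 0 <= l - k / `|a g| * `|a h|.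
    by rewrite subr_ge0 -ler_pdivlMr// ltW.
  have [y [w [e Gy hw]]] := ih _ m0.
  exists ((k / `|a g|) *: p + y), w; split=> //.
  + rewrite -addrA -e /p scalerDr !scalerA divfK ?gt_eqF//.
    rewrite [RHS]addrACA -scalerDl.
    by congr (_ *: _ + _); ring.
  + by apply: cD => //; apply: cZ; [exact: divr_ge0|exact: sub_conic].
Qed.

(** The sign [s] records on which side of the hyperplane the remainder [z] lies,
    which lets both sides be treated at once. *)
Lemma conic_split G x : conic G x -> exists y z (s : R),
  [/\ x = y + z, s != 0, conic (level G) y &
      conic (G `&` [set g | 0 < s * a g]) z].
Proof.
have [_ cD cZ] := conic_cone (level G).
elim=> [|l g {}x l0 Gg _ [y [z [s [-> s0 Gy Gz]]]]].
  exists 0, 0, 1; rewrite addr0 oner_neq0; split=> //; exact: conic0.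
have [ag|ag] := eqVneq (a g) 0.
  exists (l *: g + y), z, s; rewrite addrA; split=> //.
  by apply: conicD => //; split => //; left.
have [sag|] := ltP 0 (s * a g).
  exists y, (l *: g + z), s; rewrite addrCA; split=> //.
  exact: conicD.
rewrite le_eqVlt mulf_eq0 (negPf s0) (negPf ag)/= => sag.
have sE : [set h | 0 < s * a h] = [set h | a g * a h < 0].
  apply/seteqP; split=> h /=; case: (ltgtP s 0) s0 => // ss _;
    case: (ltgtP (a g) 0) ag sag => // ag _; nra.
rewrite sE in Gz; have [y' [w [e Gy' hw]]] := conic_absorb Gg ag l0 Gz.
have -> : l *: g + (y + z) = (y + y') + w by rewrite addrCA e addrA.
exists (y + y'), w; case: hw => [hw|[k k0 ->]].
  by exists s; rewrite sE; split=> //; exact: cD.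
exists (- s); rewrite oppr_eq0; split=> //; first exact: cD.
rewrite -[_ *: _]addr0; apply: conicD => //; last exact: conic0.
by split=> //=; rewrite mulNr oppr_gt0.
Qed.

(** One step of the double description method (Fourier-Motzkin elimination in
    its dual form). A vector with [0 <= a x] splits into a part on the hyperplane
    and a part on one side of it; if that side is the negative one, the part
    vanishes by [conic_eq0]. *)
Lemma conic_halfspace G :
  conic (balance G `&` [set x | 0 <= a x]) = conic G `&` [set x | 0 <= a x].
Proof.
have [c0 cD cZ] := conic_cone G.
apply/seteqP; split=> x.
  apply: conic_sub => [|{}x [Gx ax]].
    split=> [|{}x y [Gx /= ax] [Gy /= ay]|l {}x l0 [Gx /= ax]].
    - by split=> //=; rewrite a0.
    - by split; [exact: cD|rewrite /= aD addr_ge0].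
    - by split; [exact: cZ|rewrite /= aZ mulr_ge0].
  split=> //; case: Gx => [/sub_conic//|[g /sub_conic Gg [h /sub_conic Gh <-]]].
  by apply: cD; exact: cZ.
move=> [/conic_split[y [z [s [-> s0 Gy Gz]]]] /= ax].
have [_ eD _] := conic_cone (balance G `&` [set x | 0 <= a x]).
have ay : a y = 0.
  move: Gy; apply: (@conic_sub _ [set y | a y = 0]) => [|u []//].
  split=> /= [|u v au av|l u _ au]; first exact: a0.
    by rewrite aD au av addr0.
  by rewrite aZ au mulr0.
rewrite aD ay add0r in ax.
apply: eD.
  by apply: conicS Gy => u [Gu /= ->]; split => /=.
case: (ltgtP s 0) s0 => // ss _.
  by rewrite (conic_eq0 Gz) ?nmulr_rle0//; exact: conic0.
apply: conicS Gz => u [Gu /=]; rewrite pmulr_rgt0// => au.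
by split; [left|exact: ltW].
Qed.

Lemma balance_finite G : finite_set G -> finite_set (balance G).
Proof. by move=> fG; rewrite finite_setU; split=> //; exact: finite_image2. Qed.

End cut.

End double_description.

(** * Generators of polyhedra, and linear programming *)

Section polyhedral_cones.
Context {R : realFieldType}.

Lemma conic_full (V : vectType R) :
  exists2 G : set V, finite_set G & conic G = setT.
Proof.
pose e := vbasis {: V}; pose B := [set` (e : seq V)].
exists (B `|` -%R @` B).
  by rewrite finite_setU; split; last apply: finite_image; exact: finite_seq.
have [c0 cD cZ] := conic_cone (B `|` -%R @` B).
apply/seteqP; split=> // x _; rewrite (coord_vbasis (memvf x)).
apply: (big_ind (conic _)) => // i _.
have Be : B e`_i by apply: mem_nth; rewrite size_tuple.
have [l0|/ltW l0] := leP 0 (coord e i x).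
  by apply: cZ => //; apply: sub_conic; left.
rewrite -[_ *: _]opprK -scaleNr -scalerN; apply: cZ; first by rewrite oppr_ge0.
by apply: sub_conic; right; exists e`_i.
Qed.

(** The constraints are imposed one by one, starting from the whole space. *)
Lemma polyhedral_cone_generated (V : vectType R) (I : eqType)
    (f : I -> V -> R) (s : seq I) : (forall i, scalar (f i)) ->
  exists2 G, finite_set G & conic G = [set x | forall i, i \in s -> 0 <= f i x].
Proof.
move=> lin_f; elim: s => [|i s [G fG GE]].
  have [G fG GE] := conic_full V.
  by exists G; rewrite ?GE//; apply/seteqP; split.
exists (balance (f i) G `&` [set x | 0 <= f i x]).
  exact/finite_setIl/balance_finite.
rewrite conic_halfspace// GE; apply/seteqP; split=> x /=.
  by move=> [sx ix] j; rewrite inE => /predU1P[->//|]; exact: sx.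
move=> h; split=> [j js|]; apply: h; rewrite inE ?eqxx//.
by rewrite js orbT.
Qed.

End polyhedral_cones.

Section polyhedra.
Context {R : realType}.

(** Minkowski-Weyl: the polyhedron is the section at height [1] of the polyhedral
    cone [f i v >= c i * t], [t >= 0] in the space of pairs [(v, t)]. Generators of
    positive height, rescaled to height [1], are the points; generators of height
    [0] are the directions. *)
Lemma minkowski_weyl (V : vectType R) (I : finType) (f : I -> V -> R)
    (c : I -> R) : (forall i, scalar (f i)) ->
  exists B D : set V,
  [/\ finite_set B, finite_set D, B `<=` [set x | forall i, c i <= f i x],
      D `<=` [set x | forall i, 0 <= f i x] &
      [set x | forall i, c i <= f i x] `<=` conv_hull B ⊕ cone_hull D].
Proof.
move=> lin_f.
pose F (o : option I) (w : V * R^o) : R :=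
  if o is Some i then f i w.1 - c i * w.2 else w.2.
have linF o : scalar (F o).
  move=> l u v; have e2 : (l *: u + v).2 = l * u.2 + v.2 by [].
  by case: o => [i|]; rewrite /F e2//= lin_f; ring.
have [G fG GE] := polyhedral_cone_generated (enum {: option I}) linF.
have GF w o : conic G w -> 0 <= F o w by rewrite GE; apply; rewrite mem_enum.
pose B : set V := [set w.2^-1 *: w.1 | w in G `&` [set w | 0 < w.2]].
pose D : set V := [set w.1 | w in G `&` [set w | w.2 = 0]].
exists B, D; split.
- by apply: finite_image; exact: finite_setIl.
- by apply: finite_image; exact: finite_setIl.
- move=> _ [w [/sub_conic Gw /= w2] <-] i.
  have := GF _ (Some i) Gw; rewrite /= subr_ge0 (scalar_scale (lin_f i)).
  by rewrite [_^-1 * _]mulrC ler_pdivlMr.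
- move=> _ [w [/sub_conic Gw /= w2] <-] i.
  by have := GF _ (Some i) Gw; rewrite /= w2 mulr0 subr0.
(* [B] may be empty when all heights are [0]; the term [0 *: p] then vanishes
   whatever [p] is. *)
have decomp w : conic G w -> 0 <= w.2 /\ exists p d,
    [/\ w.2 = 0 \/ conv_hull B p, cone_hull D d & w.1 = w.2 *: p + d].
  have [h0 hD hZ] := cone_hull_cone D.
  elim=> [|l g {}w l0 Gg _ [w2 [p [d [hp hd we]]]]] /=.
    by split=> //; exists 0, 0; rewrite scaler0 addr0; split=> //; left.
  have := GF _ None (sub_conic Gg); rewrite /= le_eqVlt.
  move=> /predU1P[g2|g2].
    rewrite -g2; split; first by rewrite scaler0 add0r.
    exists p, (l *: g.1 + d); rewrite scaler0 add0r; split=> //.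
      by apply: hD => //; apply: hZ => //; apply: sub_cone_hull; exists g.
    by rewrite we addrCA.
  have Bg : B (g.2^-1 *: g.1) by exists g.
  have lg : 0 <= l * g.2 by rewrite mulr_ge0// ltW.
  split; first exact: addr_ge0.
  have := addr_ge0 lg w2; rewrite le_eqVlt => /predU1P[/esym z|z].
    exists p, d; split=> //; first by left.
    have /eqP : l * g.2 = 0 by lra.
    by rewrite mulf_eq0 (gt_eqF g2) orbF => /eqP ->; rewrite !scale0r !add0r.
  have lgE : l *: g.1 = (l * g.2) *: (g.2^-1 *: g.1).
    by rewrite scalerA mulfK// gt_eqF.
  case: hp => [w20|Bp].
    exists (g.2^-1 *: g.1), d; split=> //; first by right; exact: sub_conv_hull.
    by rewrite we w20 addr0 scale0r add0r lgE.
  have [u Bu uE] :=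
    convex_set_mix (conv_hull_convex (B:=B)) (sub_conv_hull Bg) Bp lg w2 z.
  by exists u, d; split=> //; [right|rewrite -uE -lgE we addrA].
move=> x cx; have Gx : conic G (x, 1).
  by rewrite GE => -[i|] _ /=; rewrite ?mulr1 ?subr_ge0// ler01.
have one_neq0 : (1 : R) = 0 -> False by move/eqP; rewrite oner_eq0.
have [_ [p [d [[/one_neq0[]|Bp] Dd /= xE]]]] := decomp _ Gx.
by exists p => //; exists d => //; rewrite xE scale1r.
Qed.

Lemma finite_set_argmin (T : choiceType) (B : set T) (g : T -> R) :
  finite_set B -> B !=set0 -> exists2 x, B x & forall y, B y -> g x <= g y.
Proof.
move=> /finite_seqP[s ->]; elim: s => [|z s ih] [y ys]; first by [].
case: s ih ys => [_ _|t s ih _].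
  by exists z => [|u]; rewrite /= ?inE// => /eqP ->.
have [|x xs hx] := ih; first by exists t; rewrite /= inE eqxx.
have [le|/ltW le] := leP (g z) (g x).
  exists z; first by rewrite /= inE eqxx.
  move=> u; rewrite /= inE => /predU1P[->//|us].
  exact: le_trans le (hx _ us).
exists x; first by rewrite /= inE [x \in _]xs orbT.
by move=> u; rewrite /= inE => /predU1P[->//|]; exact: hx.
Qed.

(** On the finitely generated form of the feasible set, directions cannot lower
    the objective, so it is minimal at the best of the finitely many points. *)
Lemma linear_program_attained (V : vectType R) (I : finType) (f : I -> V -> R)
    (c : I -> R) (g : V -> R) : (forall i, scalar (f i)) -> scalar g ->
  (forall d, (forall i, 0 <= f i d) -> 0 <= g d) ->
  (exists x, forall i, c i <= f i x) ->
  exists2 x, forall i, c i <= f i x &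
    forall y, (forall i, c i <= f i y) -> g x <= g y.
Proof.
move=> lin_f lin_g g_ge0 [x0 Qx0].
have gD := scalar_add lin_g; have gZ := scalar_scale lin_g.
have [B [D [fB fD BQ DQ QE]]] := minkowski_weyl c lin_f.
have [p Bp _] := QE _ Qx0.
have [|x Bx hx] := finite_set_argmin g fB.
  by apply: conv_hull_neq0; exists p.
exists x; first exact: BQ.
move=> y /QE[u Bu [v Dv <-]]; rewrite gD -[g x]addr0; apply: lerD.
  move: u Bu; apply: conv_hull_min => //; apply/convex_setP.
  move=> {}y z t t01 /= xy xz; rewrite gD !gZ.
  have /andP[t0 t1] := t01; nra.
move: v Dv; apply: cone_hull_min => [|v /DQ]; last exact: g_ge0.
split=> [|d e /= d0 e0|l d l0 /= d0]; first by rewrite /= (scalar_zero lin_g).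
  by rewrite gD addr_ge0.
by rewrite gZ mulr_ge0.
Qed.

End polyhedra.

(** * The vector linear program and its upper image *)

Section componentwise_order.
Context {R : realType}.

Lemma vec_leD k (u v u' v' : 'cV[R]_k) :
  u <=c v -> u' <=c v' -> u + u' <=c v + v'.
Proof. by move=> uv uv' i; rewrite !mxE; apply: lerD. Qed.

Lemma vec_leZ k (l : R) (u v : 'cV[R]_k) :
  0 <= l -> u <=c v -> (l *: u) <=c (l *: v).
Proof. by move=> l0 uv i; rewrite !mxE; apply: ler_wpM2l. Qed.

Lemma vec_sub_ge0 k (u v : 'cV[R]_k) : (0 <=c (v - u)) <-> (u <=c v).
Proof. by split=> h i; have := h i; rewrite !mxE subr_ge0. Qed.

Lemma halfspaces_cone k l (M : 'M[R]_(l, k)) :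
  convex_cone [set x : 'cV[R]_k | 0 <=c M *m x].
Proof.
split=> [|x y /= Mx My|a x a0 /= Mx] /=.
- by rewrite mulmx0.
- by rewrite mulmxDr -[X in X <=c _]addr0; exact: vec_leD.
- by rewrite -scalemxAr -[X in X <=c _](scaler0 _ a); exact: vec_leZ.
Qed.

End componentwise_order.

Section vector_linear_program.
Context {R : realType} {n m q r : nat}.
Context (A : 'M[R]_(m, n)) (P : 'M[R]_(q, n)) (Z : 'M[R]_(q, r)) (b : 'cV[R]_m).
Hypothesis kerZ : [set v : 'cV[R]_q | Z^T *m v = 0] = [set 0].

Let C := ordering_cone Z.
Let PP := upper_image A P Z b.

Lemma ordering_cone_cone : convex_cone C.
Proof. exact: halfspaces_cone. Qed.

Lemma ordering_coneB y z : C (y - z) <-> Z^T *m z <=c Z^T *m y.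
Proof. by rewrite /C /ordering_cone /= mulmxBr; exact: vec_sub_ge0. Qed.

Lemma ordering_cone_pointed y : C y -> C (- y) -> y = 0.
Proof.
move=> Cy Cny; suff : [set v : 'cV[R]_q | Z^T *m v = 0] y by rewrite kerZ.
apply/matrixP => i j; rewrite ord1; apply: le_anti.
have := Cny i; have := Cy i; rewrite mulmxN !mxE; lra.
Qed.

Lemma upper_imageE :
  PP = [set y | exists2 x, feasible_set A b x & C (y - P *m x)].
Proof.
apply/seteqP; split=> y [x].
  by move=> [Zx Ax]; exists x => //; exact/ordering_coneB.
by move=> Sx /ordering_coneB Zx; exists x.
Qed.

Lemma image_feasible_upper x : feasible_set A b x -> PP (P *m x).
Proof.
move=> Sx; rewrite upper_imageE; exists x => //; rewrite subrr.
by case: ordering_cone_cone.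
Qed.

(** Both the image of a feasible direction and an element of the ordering cone
    are recession directions of the upper image; this covers their sums. *)
Lemma upper_image_recession x y : feasible_dirs A x -> C (y - P *m x) ->
  recession_cone PP y.
Proof.
have [_ CD CZ] := ordering_cone_cone.
move=> Ax Cy; rewrite upper_imageE => z t [u Su Cu] t0 /=.
exists (u + t *: x).
  rewrite /feasible_set /= mulmxDr -scalemxAr -[X in X <=c _]addr0.
  apply: vec_leD => //; rewrite -[X in X <=c _](scaler0 _ t).
  exact: vec_leZ.
rewrite mulmxDr opprD addrACA; apply: CD => //.
by rewrite -scalemxAr -scalerBr; exact: CZ.
Qed.

Lemma ordering_cone_recession : C `<=` recession_cone PP.
Proof.
move=> c Cc; apply: (@upper_image_recession 0).
  by rewrite /feasible_dirs /= mulmx0.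
by rewrite mulmx0 subr0.
Qed.

Lemma upper_image_convex : @convex_set R _ PP.
Proof.
have [_ CD CZ] := ordering_cone_cone.
rewrite upper_imageE; apply/convex_setP => y z t /andP[t0 t1].
have {}t1 : 0 <= 1 - t by lra.
move=> [u Su Cu] [v Sv Cv]; exists (t *: u + (1 - t) *: v).
  rewrite /feasible_set /= mulmxDr -!scalemxAr.
  have -> : b = t *: b + (1 - t) *: b by rewrite -scalerDl addrC subrK scale1r.
  by apply: vec_leD; apply: vec_leZ => //; exact: ltW.
rewrite mulmxDr opprD addrACA -!scalemxAr -!scalerBr.
by apply: CD; apply: CZ => //; exact: ltW.
Qed.

(** The constraints of the projection problem as scalar functions on the pairs
    [(x, y)], the form required by [minkowski_weyl]. *)
Definition pp_constraint (i : 'I_r + 'I_m) (w : 'cV[R]_n * 'cV[R]_q) : R :=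
  match i with
  | inl k => (Z^T *m (w.2 - P *m w.1)) k 0
  | inr j => (A *m w.1) j 0
  end.

Definition pp_bound (i : 'I_r + 'I_m) : R := if i is inr j then b j 0 else 0.

Lemma pp_constraint_scalar i : scalar (pp_constraint i).
Proof.
case: i => k l u v /=.
  have -> : l *: u.2 + v.2 - P *m (l *: u.1 + v.1) =
      l *: (u.2 - P *m u.1) + (v.2 - P *m v.1).
    by rewrite mulmxDr -scalemxAr opprD addrACA scalerBr.
  by rewrite mulmxDr -scalemxAr !mxE.
by rewrite mulmxDr -scalemxAr !mxE.
Qed.

Lemma pp_constraint_feasible w : (forall i, pp_bound i <= pp_constraint i w) <->
  Z^T *m (P *m w.1) <=c Z^T *m w.2 /\ b <=c A *m w.1.
Proof.
split=> [h|[h k] [i|i] /=].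
- split=> i; last exact: (h (inr i)).
  by have := h (inl i); rewrite /= mulmxBr !mxE subr_ge0.
- by rewrite mulmxBr; have /vec_sub_ge0/(_ i) := h; rewrite mxE.
- exact: k.
Qed.

Lemma pp_constraint_dir w : (forall i, 0 <= pp_constraint i w) <->
  Z^T *m (P *m w.1) <=c Z^T *m w.2 /\ 0 <=c A *m w.1.
Proof.
split=> [h|[h k] [i|i] /=].
- split=> i; last by have := h (inr i); rewrite mxE.
  by have := h (inl i); rewrite /= mulmxBr !mxE subr_ge0.
- by rewrite mulmxBr; have /vec_sub_ge0/(_ i) := h; rewrite mxE.
- by have := k i; rewrite mxE.
Qed.

(** Generators of the polyhedron of pairs [(x, y)] project to generators of the
    upper image. A direction [(x, y)] with [y = 0] is not allowed in a solution
    and contributes nothing to the projection, so it is dropped. *)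
Lemma pp_solution_exists : feasible_set A b !=set0 ->
  exists Xpoi Xdir, pp_solution A P Z b Xpoi Xdir.
Proof.
move=> [x0 Sx0].
have [B [D [fB fD BQ DQ QE]]] := minkowski_weyl pp_bound pp_constraint_scalar.
have Q0 : [set w | forall i, pp_bound i <= pp_constraint i w] (x0, P *m x0).
  by apply/pp_constraint_feasible; split.
exists B, (D `&` [set w | w.2 <> 0]); split.
- split=> // [|x y /BQ /pp_constraint_feasible//].
  by have [p Bp _] := QE _ Q0; apply: conv_hull_neq0; exists p.
- exact: finite_setIl.
- by move=> x y [/DQ /pp_constraint_dir[]].
pose E := snd @` (D `&` [set w | w.2 <> 0]).
have cE := cone_hull_cone E; have [E0 _ _] := cE.
apply/seteqP; split=> y.
  move=> [x Hx]; have /QE[u Bu [v Dv uv]] :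
      [set w | forall i, pp_bound i <= pp_constraint i w] (x, y).
    exact/pp_constraint_feasible.
  exists u.2; first by apply: (conv_hull_image (g := snd)); exists u.
  exists v.2; last by rewrite -[RHS]/((x, y).2) -uv.
  have : cone_hull (snd @` D) v.2.
    by apply: (cone_hull_image (g := snd)); exists v.
  apply: cone_hull_min => // _ [w Dw <-].
  have [->|/eqP w0] := eqVneq w.2 0; first exact: E0.
  by apply: sub_cone_hull; exists w.
move=> [u Bu [v Dv <-]]; apply: recession_coneD.
  move: u Bu; apply: conv_hull_min; first exact: upper_image_convex.
  move=> _ [w /BQ /pp_constraint_feasible Bw <-].
  by exists w.1.
move: v Dv; apply: cone_hull_min; first exact: recession_cone_cone.
move=> _ [w [/DQ /pp_constraint_dir [Zw Aw] _] <-].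
apply: (upper_image_recession Aw).
by exact/ordering_coneB.
Qed.

(** Among the [u] in the upper image with [y - u] in the ordering cone, one that
    minimizes the sum of the coordinates of [Z^T u] is undominated: a point that
    dominates [u] is a competitor, and the sum of the coordinates of [Z^T d] is
    positive for [d] nonzero in the pointed ordering cone. The minimum is attained
    because the negative of a recession direction of this set of competitors lies
    both in the ordering cone and in the lineality space, hence vanishes. *)
Lemma undominated_below y : lineality_space PP `&` C = [set 0] -> PP y ->
  exists2 c, C c & PP (y - c) /\ undominated C PP (y - c).
Proof.
move=> LC0 PPy; have [_ CD _] := ordering_cone_cone.
pose f (i : 'I_r + 'I_m + 'I_r) (w : 'cV[R]_n * 'cV[R]_q) : R :=
  match i with inl i => pp_constraint i w | inr k => - (Z^T *m w.2) k 0 end.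
pose c (i : 'I_r + 'I_m + 'I_r) : R :=
  match i with inl i => pp_bound i | inr k => - (Z^T *m y) k 0 end.
pose g (w : 'cV[R]_n * 'cV[R]_q) : R := \sum_k (Z^T *m w.2) k 0.
have Z_scalar k : scalar (fun w : 'cV[R]_n * 'cV[R]_q => (Z^T *m w.2) k 0).
  by move=> l u v /=; rewrite mulmxDr -scalemxAr !mxE.
have lin_f i : scalar (f i).
  case: i => i; first exact: pp_constraint_scalar.
  by move=> l u v; rewrite /f Z_scalar; ring.
have lin_g : scalar g.
  move=> l u v; rewrite /g mulr_sumr -big_split; apply: eq_bigr => k _.
  exact: Z_scalar.
have fE w : (forall i, c i <= f i w) <->
    (forall i, pp_bound i <= pp_constraint i w) /\ C (y - w.2).
  split=> [h|[h1 h2] [i|k]].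
  - split=> [i|k]; first exact: (h (inl i)).
    by have := h (inr k); rewrite /= mulmxBr !mxE; lra.
  - exact: h1.
  - by have := h2 k; rewrite /= mulmxBr !mxE; lra.
have PPE w : (forall i, pp_bound i <= pp_constraint i w) -> PP w.2.
  by move=> /pp_constraint_feasible h; exists w.1.
have g_ge0 w : (forall i, 0 <= f i w) -> 0 <= g w.
  move=> h; have /pp_constraint_dir[Zw Aw] := fun i => h (inl i).
  have Cw : C (- w.2).
    by move=> k; have := h (inr k); rewrite /= mulmxN !mxE.
  have rw : recession_cone PP w.2.
    apply: (upper_image_recession Aw).
    by exact/ordering_coneB.
  have : (lineality_space PP `&` C) (- w.2).
    split=> //; split; first exact: ordering_cone_recession.
    by exists w.2.
  rewrite LC0 => /= /eqP; rewrite oppr_eq0 => /eqP w20.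
  by rewrite /g w20 big1// => k _; rewrite mulmx0 mxE.
have [x0 Hx0] := PPy.
have w0P i : c i <= f i (x0, y).
  apply: (fE (x0, y)).2; split; first exact/pp_constraint_feasible.
  by rewrite subrr; case: ordering_cone_cone.
have [w /fE[wPP Cw] hw] :=
  linear_program_attained lin_f lin_g g_ge0 (ex_intro _ (x0, y) w0P).
exists (y - w.2) => //; rewrite subKr; split; first exact: PPE.
move=> [u [x Hx] [d [Cd d0] ud]]; apply: d0 => /=.
have gu : g w <= g (x, u).
  apply: hw; apply/fE; split; first exact/pp_constraint_feasible.
  have -> : y - (x, u).2 = y - w.2 + d by rewrite -ud opprD addrA subrK.
  exact: CD.
have dZ k : (0 : R) <= (Z^T *m d) k 0 by have := Cd k; rewrite mxE.
have gw : g w = g (x, u) + \sum_k (Z^T *m d) k 0.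
  rewrite /g -big_split; apply: eq_bigr => k _.
  by rewrite -ud mulmxDr mxE.
have /eqP : \sum_k (Z^T *m d) k 0 = 0.
  by apply: le_anti; rewrite sumr_ge0// andbT; lra.
rewrite psumr_eq0// => /allP dZ0.
apply: ordering_cone_pointed => // k; rewrite mulmxN !mxE.
by have /eqP := dZ0 k (mem_index_enum k); rewrite mxE => ->; rewrite oppr0.
Qed.

(** [y] differs from [P x] by an element of the ordering cone, so an undominated
    [y] can only be [P x] itself. *)
Lemma undominated_eq_image (x : 'cV[R]_n) (y : 'cV[R]_q) Y :
  Z^T *m (P *m x) <=c Z^T *m y -> Y (P *m x) -> undominated C Y y -> y = P *m x.
Proof.
move=> Zxy Yx uy; apply: contrapT => yx; apply: uy.
exists (P *m x) => //; exists (y - P *m x); last by rewrite addrC subrK.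
split; first by exact/ordering_coneB.
by move=> /= /eqP; rewrite subr_eq0 => /eqP.
Qed.

(** Every point of the upper image lies above an undominated one, whose
    generators are all undominated and are therefore images under [P] of the
    selected [x]. *)
Lemma vlp_solution_of_pp Xpoi Xdir :
  pp_solution A P Z b Xpoi Xdir -> lineality_space PP `&` C = [set 0] ->
  vlp_solution A P Z b
    [set x | exists y, Xpoi (x, y) /\ undominated C PP y]
    [set x | exists y, Xdir (x, y) /\ undominated C (recession_cone PP) y].
Proof.
move=> [[[w0 Xw0] fpoi Hpoi] fdir Hdir XE] LC0.
set Spoi := [set x | _]; set Sdir := [set x | _].
have [_ rD _] := recession_cone_cone PP.
have poiE x y : Xpoi (x, y) -> undominated C PP y -> y = P *m x.
  move=> /Hpoi[Zxy Ax] uy; apply: undominated_eq_image uy => //.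
  exact: image_feasible_upper.
have dir_rec x : feasible_dirs A x -> recession_cone PP (P *m x).
  move=> Ax; apply: (upper_image_recession Ax); rewrite subrr.
  by case: ordering_cone_cone.
have dirE x y : Xdir (x, y) -> undominated C (recession_cone PP) y ->
    y = P *m x.
  move=> /Hdir[_ Zxy Ax] uy; apply: undominated_eq_image uy => //.
  exact: dir_rec.
have SpoiF : Spoi `<=` feasible_set A b by move=> x [y [/Hpoi[]]].
have SdirF : Sdir `<=` feasible_dirs A by move=> x [y [/Hdir[]]].
have Sdir0 : Sdir `<=` feasible_dirs A `\ 0.
  move=> x Sx; split; first exact: SdirF.
  move=> /= x0; case: Sx => y [Xxy uy]; have [y0 _ _] := Hdir _ _ Xxy.
  by apply: y0; rewrite (dirE _ _ Xxy uy) x0 mulmx0.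
have poiPP : snd @` Xpoi `<=` PP.
  by move=> _ [[x y] /Hpoi h <-]; exists x.
have dirPP : snd @` Xdir `<=` recession_cone PP.
  move=> _ [[x y] /Hdir[_ Zxy Ax] <-]; apply: (upper_image_recession Ax).
  by exact/ordering_coneB.
have poi_sub : snd @` Xpoi `&` undominated C PP `<=` mulmx P @` Spoi.
  move=> _ [[[x y] Xxy <-] uy]; exists x; last by rewrite (poiE _ _ Xxy).
  by exists y.
have dir_sub : snd @` Xdir `&` undominated C (recession_cone PP) `<=`
    mulmx P @` Sdir.
  move=> _ [[[x y] Xxy <-] uy]; exists x; last by rewrite (dirE _ _ Xxy).
  by exists y.
have decomp y : PP y ->
    (conv_hull (mulmx P @` Spoi) ⊕ cone_hull (mulmx P @` Sdir) ⊕ C) y.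
  move=> /(undominated_below LC0)[c Cc [PPyc uyc]].
  have [u Xu [v Xv uv]] :
      (conv_hull (snd @` Xpoi) ⊕ cone_hull (snd @` Xdir)) (y - c).
    by rewrite -XE.
  exists (y - c); last by exists c => //; rewrite subrK.
  rewrite -uv in uyc; exists u.
    apply: sub_smallest2r poi_sub _ _; first exact: conv_hull_convex.
    apply: undominated_conv uyc => //.
    - exact: ordering_cone_cone.
    - exact: upper_image_convex.
    - by apply: cone_hull_min Xv => //; exact: recession_cone_cone.
  exists v => //; apply: cone_hullS dir_sub _ _.
  apply: undominated_cone uyc => //; first exact: ordering_cone_cone.
  by apply: conv_hull_min Xu => //; exact: upper_image_convex.
split.
- split=> //.
  + have PPw0 : PP w0.2 by apply: poiPP; exists w0.
    have [_ [u Su _] _] := decomp _ PPw0.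
    by have [_ [x Sx _]] := conv_hull_neq0 (ex_intro _ u Su); exists x.
  + apply: sub_finite_set (finite_image fst fpoi) => x [y [Xxy _]].
    by exists (x, y).
- split=> //; apply: sub_finite_set (finite_image fst fdir) => x [y [Xxy _]].
  by exists (x, y).
- apply/seteqP; split=> // _ [_ [u Su [v Sv <-]] [c Cc <-]].
  apply: recession_coneD; last exact: ordering_cone_recession.
  apply: recession_coneD.
    apply: conv_hull_min Su; first exact: upper_image_convex.
    by move=> _ [x /SpoiF Sx <-]; exact: image_feasible_upper.
  apply: cone_hull_min Sv; first exact: recession_cone_cone.
  by move=> _ [x /SdirF Sx <-]; exact: dir_rec.
- move=> x Sx; split; first exact: SpoiF.
  case: Sx => y [Xxy uy] [_ [x' Sx' <-] [c Cc ce]]; apply: (uy).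
  exists (P *m x'); first exact: image_feasible_upper.
  by exists c => //; rewrite ce (poiE _ _ Xxy uy).
- move=> x Sx; split; first exact: Sdir0.
  case: Sx => y [Xxy uy] [_ [x' Sx' <-] [c Cc ce]]; apply: (uy).
  exists (P *m x'); first exact: dir_rec.
  by exists c => //; rewrite ce (dirE _ _ Xxy uy).
Qed.

(** If [c] is a nonzero element of the ordering cone along which the upper image
    is a union of lines, then for every feasible [x] the point [P x - c] is still
    in the upper image, so [P x] is dominated: there are no minimizers at all,
    whereas a solution has at least one point. *)
Lemma vlp_no_solution : lineality_space PP `&` C <> [set 0] ->
  ~ exists Spoi Sdir, vlp_solution A P Z b Spoi Sdir.
Proof.
have [C0 CD CZ] := ordering_cone_cone.
move=> LC [Spoi [Sdir [[[x Sx] _ SF] _ _ minS _]]]; apply: LC.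
apply/seteqP; split=> [c [[_ [e re <-]] Cc]|_ ->].
  (* Here [c] is [- e], where [e] is a recession direction. *)
  apply: contrapT => /= e0.
  have [_] := minS _ Sx; apply.
  have : PP (P *m x + e).
    by apply: recession_coneD => //; exact/image_feasible_upper/SF.
  rewrite upper_imageE => -[x' Sx' Cx'].
  exists (P *m x'); first by exists x'.
  exists (P *m x + e - P *m x' - e); last first.
    by rewrite [_ - _ - e]addrAC addrK addrCA subrr addr0.
  split; first by apply: CD.
  move=> /= d0; apply: e0.
  apply: ordering_cone_pointed => //; rewrite opprK.
  have eE : P *m x + e - P *m x' = e.
    by apply/eqP; rewrite -subr_eq0; apply/eqP.
  by rewrite eE in Cx'.
have [r0 _ _] := recession_cone_cone PP.
by split=> //; split=> //; exists 0; rewrite ?oppr0.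
Qed.

End vector_linear_program.

Theorem theorem5 (R : realType) (n m q r : nat)
    (n_gt0 : (0 < n)%N) (m_gt0 : (0 < m)%N)
    (q_gt0 : (0 < q)%N) (r_gt0 : (0 < r)%N)
    (A : 'M[R]_(m, n)) (P : 'M[R]_(q, n)) (Z : 'M[R]_(q, r)) (b : 'cV[R]_m)
    (kerZ : [set v : 'cV[R]_q | Z^T *m v = 0] = [set 0])
    (feasible : feasible_set A b !=set0) :
  let C := ordering_cone Z in
  let PP := upper_image A P Z b in
  let L := lineality_space PP in
  [/\ exists Xpoi Xdir : set ('cV[R]_n * 'cV[R]_q),
        pp_solution A P Z b Xpoi Xdir,
      forall Xpoi Xdir : set ('cV[R]_n * 'cV[R]_q),
        pp_solution A P Z b Xpoi Xdir ->
        L `&` C = [set 0] ->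
        let Spoi := [set x : 'cV[R]_n | exists y : 'cV[R]_q,
          Xpoi (x, y) /\ ~ (PP ⊕ (C `\ 0)) y] in
        let Sdir := [set x : 'cV[R]_n | exists y : 'cV[R]_q,
          Xdir (x, y) /\ ~ (recession_cone PP ⊕ (C `\ 0)) y] in
        vlp_solution A P Z b Spoi Sdir
    & L `&` C <> [set 0] ->
        ~ exists Spoi Sdir : set 'cV[R]_n, vlp_solution A P Z b Spoi Sdir].
Proof.
split; first exact: pp_solution_exists.
- by move=> Xpoi Xdir; exact: vlp_solution_of_pp.
- exact: vlp_no_solution.
Qed.
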